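(* For every $n\in\mathbb{N}$, $n\ge1$, the expected gain $g(n)=\mathbb{E}[G_n]$ is given by $$g(n)=\sum_{k=1}^n k\cdot p_{k,n}=e^{n}\,n^{-n}\,\Gamma(n+1,n)-1,$$ where $\Gamma(a,x)=\int_x^\infty t^{a-1}e^{-t}\,dt$ is the upper incomplete Gamma function.
   Context: Let $X_1,X_2,\ldots$ be independent random variables, each uniformly distributed on $\{1,2,\ldots,n\}$. The gain is $G_n=\min\{k\in\{1,\ldots,n\}: X_k\le k\}$ (well defined since $X_n\le n$). Its probability mass function is $p_{k,n}=\mathbb{P}(G_n=k)=\frac{k}{n^k}\cdot\frac{(n-1)!}{(n-k)!}$ for $1\le k\le n$. *)

(* Defs.v *)
From HB Require Import structures.
From mathcomp Require Import all_boot all_order all_algebra finmap.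
From mathcomp Require Import all_classical all_reals all_analysis.
Import Order.TTheory GRing.Theory Num.Theory.
Import numFieldNormedType.Exports.

Set Implicit Arguments.
Unset Strict Implicit.
Unset Printing Implicit Defensive.

Local Open Scope classical_set_scope.
Local Open Scope ring_scope.

(* Mutual independence of the subfamily of X indexed by D: the product rule
   holds for every finite J included in D and all measurable sets. *)
Definition mutually_independent (I : choiceType) (d d' : measure_display)
    (T : measurableType d) (T' : measurableType d') (R : realType)
    (P : probability T R) (D : set I) (X : I -> {RV P >-> T'}) : Prop :=
  forall J : {fset I}, [set` J] `<=` D ->
  forall A : I -> set T', (forall i, measurable (A i)) ->
  P (\bigcap_(i in [set` J]) (X i @^-1` A i)) =
    (\prod_(i <- J) P (X i @^-1` A i))%E.

Definition uniform_on_1n (d : measure_display) (T : measurableType d)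
    (R : realType) (P : probability T R) (n : nat) (X : {RV P >-> nat}) : Prop :=
  forall j : nat, distribution P X [set j] =
    (if (0 < j <= n)%N then n%:R^-1 else 0)%:E.

(* The minimum of {k in {1, ..., n} | x k <= k}. The value n of an empty
   minimum is harmless: every candidate k is at most n, and the set is empty
   only if x n > n, which has probability 0 when x n is uniform on
   {1, ..., n}. *)
Definition first_hit (n : nat) (x : nat -> nat) : nat :=
  \big[minn/n]_(1 <= k < n.+1 | (x k <= k)%N) k.

Definition gain_fun (d : measure_display) (T : measurableType d)
    (R : realType) (P : probability T R) (X : nat -> {RV P >-> nat})
    (n : nat) (w : T) : R :=
  (first_hit n (fun k => X k w))%:R.

Lemma measurable_gain_fun (d : measure_display) (T : measurableType d)
    (R : realType) (P : probability T R) (X : nat -> {RV P >-> nat})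
    (n : nat) : measurable_fun [set: T] (gain_fun X n).
Proof.
rewrite /gain_fun.
apply: (@measurableT_comp _ _ _ _ _ _ (fun m : nat => m%:R : R)) => //.
rewrite /first_hit /index_iota.
elim: (iota _ _) => [|k s ih].
  by under eq_fun do rewrite big_nil; exact: measurable_cst.
have mX : measurable_fun [set: T] (X k : T -> nat) by [].
under eq_fun do rewrite big_cons.
apply: measurable_fun_if => //.
- apply: (@measurableT_comp _ _ _ _ _ _ (fun m : nat => (m <= k)%N)) => //.
- apply: measurable_funTS.
  exact: (@measurableT_comp _ _ _ _ _ _ (minn k)).
- exact: measurable_funTS.
Qed.

HB.instance Definition _ (d : measure_display) (T : measurableType d)
    (R : realType) (P : probability T R) (X : nat -> {RV P >-> nat})
    (n : nat) :=
  isMeasurableFun.Build _ _ _ _ (gain_fun X n) (measurable_gain_fun X n).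

Definition gain (d : measure_display) (T : measurableType d)
    (R : realType) (P : probability T R) (X : nat -> {RV P >-> nat})
    (n : nat) : {RV P >-> R} := gain_fun X n.

(* For x >= 0. The integral is extended-real valued, so that no convention
   for a divergent integral is involved. *)
Definition upper_incomplete_gamma (R : realType) (a x : R) : \bar R :=
  (\int[lebesgue_measure]_(t in `[x, +oo[) (t `^ (a - 1) * expR (- t))%:E)%E.

(* Main.v *)
(** Write S_k = P(G_n > k).  For k < n, the event G_n > k says that X_j > j for
    all 1 <= j <= k, so by independence
    S_k = prod_(j <= k) (1 - j/n) = (n-1)(n-2)...(n-k) / n^k,
    and S_n = 0 fits the same formula.  Abel summation gives
    E[G_n] = sum_(k < n) S_k.  On the other side, a polynomial p satisfies
    int_a^oo p(t) e^-t dt = e^-a (p + p' + p'' + ...)(a); for p = X^n and a = n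
    this is n^n e^-n (1 + sum_(k < n) S_k). *)
Require Import Defs.
From HB Require Import structures.
From mathcomp Require Import all_boot all_order all_algebra finmap.
From mathcomp Require Import all_classical all_reals all_analysis.
From mathcomp Require Import measurable_realfun ring.
Import Order.TTheory GRing.Theory Num.Theory.
Import numFieldNormedType.Exports.

Local Open Scope classical_set_scope.
Local Open Scope ring_scope.

(** * First hits, tail summation and falling factorials *)

Lemma ltn_bigminn (s : seq nat) (Q : pred nat) (n k : nat) :
  (k < \big[minn/n]_(j <- s | Q j) j)%N =
  (k < n)%N && all (fun j => Q j ==> (k < j)%N) s.
Proof.
elim: s => [|j s IH]; first by rewrite big_nil andbT.
by rewrite big_cons /=; case: (Q j) => //=; rewrite leq_min IH andbCA.
Qed.

(** A minimum exceeds k exactly when its default value and all its candidates do. The default n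
    gives [k < n], and no j in 1..k may be a candidate. *)
Lemma ltn_first_hit (n k : nat) (x : nat -> nat) :
  reflect ((k < n)%N /\ forall j, (0 < j <= k)%N -> (j < x j)%N)
          (k < first_hit n x)%N.
Proof.
rewrite /first_hit ltn_bigminn; apply: (iffP andP) => -[kn].
  move=> /allP xgt; split=> // j /andP[j_gt0 jk].
  have := xgt j; rewrite mem_index_iota j_gt0 ltnS (leq_trans jk (ltnW kn)).
  by move=> /(_ isT); rewrite ltnNge jk implybF -ltnNge.
move=> xgt; split=> //; apply/allP => j.
rewrite mem_index_iota => /andP[j_gt0 _].
apply/implyP; apply: contraTT; rewrite -leqNgt -ltnNge => jk.
by rewrite xgt ?j_gt0.
Qed.

Lemma first_hit_bounds (n : nat) (x : nat -> nat) :
  (0 < n)%N -> (0 < first_hit n x <= n)%N.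
Proof.
move=> n_gt0; rewrite [X in _ && X]leqNgt; apply/andP; split.
  by apply/ltn_first_hit; split=> // j /andP[/leq_trans h /h].
by apply/ltn_first_hit => -[]; rewrite ltnn.
Qed.

Lemma sum_by_tails (R : comNzRingType) (S : nat -> R) (n : nat) :
  \sum_(1 <= k < n.+1) k%:R * (S k.-1 - S k) =
  \sum_(0 <= k < n) S k - n%:R * S n.
Proof.
elim: n => [|n IH]; first by rewrite !big_geq// mul0r subr0.
rewrite big_nat_recr//= IH big_nat_recr//= -[n.+1%:R]natr1; ring.
Qed.

(** The factor at j = k+1 is (n-1-k)/n, and n-1-k is also what the falling factorial gains from k to
    k+1; [k < n] keeps this subtraction exact. *)
Lemma prod_ffact (F : fieldType) (n k : nat) : n%:R != 0 :> F -> (k < n)%N ->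
  \prod_(1 <= j < k.+1) (1 - j%:R / n%:R) = (n.-1 ^_ k)%:R / n%:R ^+ k :> F.
Proof.
move=> n0; elim: k => [|k IH] kn; first by rewrite big_geq// divr1.
rewrite big_nat_recr//= IH ?(ltnW kn)// ffactnSr natrM exprSr invfM mulrACA.
congr (_ * _); case: n n0 kn {IH} => //= n n0 kn.
by rewrite -[X in X - _](divff n0) -mulrBl -natrB ?subSS// ltnW.
Qed.

(** * Law and expectation of the gain *)

Section gain.
Context (R : realType) (d : measure_display) (T : measurableType d)
  (P : probability T R) (n : nat) (X : nat -> {RV P >-> nat}).

(** Induction on j: the tail at j loses the atom j+1, of mass 1/n. It starts from total mass 1,
    since 0 has mass 0. *)
Lemma uniform_tail (Y : {RV P >-> nat}) (j : nat) : uniform_on_1n n Y ->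
  (j <= n)%N -> P (Y @^-1` [set m | (j < m)%N]) = (1 - j%:R / n%:R)%:E.
Proof.
move=> Yu; elim: j => [|j IH] jn.
  have P0 : P (Y @^-1` [set 0%N]) = 0%E := Yu 0%N.
  rewrite mul0r subr0 -[RHS](probability_setT P).
  rewrite (_ : _ @^-1` _ = ~` (Y @^-1` [set 0%N])); last first.
    by apply/seteqP; split => w /=; rewrite lt0n => /eqP.
  rewrite probability_setC ?P0 ?sube0 ?probability_setT//.
  exact: measurable_funPTI.
have := IH (ltnW jn).
have -> : P (Y @^-1` [set m | (j < m)%N]) =
    (P (Y @^-1` [set j.+1]) + P (Y @^-1` [set m | (j.+1 < m)%N]))%E.
  rewrite -measureU; [|exact: measurable_funPTI..|]; last first.
    by apply/seteqP; split => // w /= [->]; rewrite ltnn.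
  congr (P _); apply/seteqP; split => w /= => [|[->//|/ltnW//]].
  by rewrite leq_eqVlt => /predU1P[->|]; [left|right].
have -> : P (Y @^-1` [set j.+1]) = n%:R^-1%:E.
  by have := Yu j.+1; rewrite jn.
(* Infinite values are excluded by the induction hypothesis, whose right-hand side is finite. *)
case: (P _) => [r||]//; rewrite -EFinD => -[rE].
by rewrite -natr1 mulrDl mul1r opprD addrA -rE addrC addKr.
Qed.

Lemma gain_tail (k : nat) : (0 < n)%N ->
  (forall k, (0 < k)%N -> uniform_on_1n n (X k)) ->
  mutually_independent [set k | (0 < k)%N] X -> (k <= n)%N ->
  P [set w | (k < first_hit n (X ^~ w))%N] =
  ((n.-1 ^_ k)%:R / n%:R ^+ k)%:E.
Proof.
move=> n_gt0 Xu Xi; rewrite leq_eqVlt => /predU1P[->|kn].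
  (* At k = n both sides vanish: the event is empty and the falling factorial contains the factor
     0. *)
  rewrite ffact_small ?ltn_predL// mul0r.
  rewrite (_ : [set w | _] = set0) ?measure0//.
  by apply/seteqP; split => // w /= /ltn_first_hit[]; rewrite ltnn.
rewrite (_ : [set w | _] = \bigcap_(j in [set` [fset j | j in iota 1 k]%fset])
    (X j @^-1` [set m | (j < m)%N])); last first.
  apply/seteqP; split => w /=.
    move=> /ltn_first_hit[_ h] j /=; rewrite !inE/= mem_iota => jk.
    by apply: h; rewrite -ltnS -add1n.
  move=> h; apply/ltn_first_hit; split => // j jk; apply: h => /=.
  by rewrite !inE/= mem_iota add1n ltnS.
rewrite (Xi _ _ (fun j => [set m | (j < m)%N])) //; last first.
  by move=> j /=; rewrite !inE/= mem_iota => /andP[].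
rewrite (perm_big (index_iota 1 k.+1)); last first.
  apply: uniq_perm (fset_uniq _) (iota_uniq _ _) _ => j.
  by rewrite !inE/= subn1.
rewrite -prod_ffact ?pnatr_eq0 ?gtn_eqF// -prodEFin big_nat [RHS]big_nat.
apply: eq_bigr => j /andP[j_gt0 jk].
by rewrite uniform_tail ?(leq_trans _ (ltnW kn))//; exact: Xu.
Qed.

Lemma gain_eq (k : nat) :
  gain X n @^-1` [set k%:R] = [set w | first_hit n (X ^~ w) = k].
Proof.
by apply/seteqP; split => w /= => [/eqP|<-//]; rewrite eqr_nat => /eqP.
Qed.

(** The event G > k-1 is the disjoint union of G = k and G > k, so the mass at k is a difference of
    consecutive tails. *)
Lemma pmf_gain (k : nat) : (0 < n)%N ->
  (forall k, (0 < k)%N -> uniform_on_1n n (X k)) ->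
  mutually_independent [set k | (0 < k)%N] X -> (0 < k <= n)%N ->
  pmf (gain X n) k%:R =
  (n.-1 ^_ k.-1)%:R / n%:R ^+ k.-1 - (n.-1 ^_ k)%:R / n%:R ^+ k.
Proof.
move=> n_gt0 Xu Xi /andP[k_gt0 kn].
have mlt : measurable [set w | (k < first_hit n (X ^~ w))%N].
  rewrite (_ : [set w | _] = gain X n @^-1` `]k%:R, +oo[).
    exact: measurable_funPTI.
  by apply/seteqP; split => w /=; rewrite in_itv/= andbT ltr_nat.
have := gain_tail k.-1 n_gt0 Xu Xi (leq_trans (leq_pred k) kn).
have -> : P [set w | (k.-1 < first_hit n (X ^~ w))%N] =
    (P [set w | first_hit n (X ^~ w) = k] +
     P [set w | (k < first_hit n (X ^~ w))%N])%E.
  rewrite -measureU//; first last.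
  - by apply/seteqP; split => // w /= [->]; rewrite ltnn.
  - by rewrite -gain_eq; exact: measurable_funPTI.
  congr (P _); apply/seteqP; split => w /=; rewrite prednK//.
    by rewrite leq_eqVlt => /predU1P[->|]; [left|right].
  by case=> [->|/ltnW].
rewrite gain_tail// /pmf gain_eq.
case: (P _) => [r||]//; rewrite -EFinD => -[<-].
by rewrite addrK.
Qed.

(** All values of the gain lie in 1..n, so it is the finite sum of k times the indicator of G = k,
    which is integrated term by term. *)
Lemma expectation_gain : (0 < n)%N ->
  ('E_P[gain X n] = (\sum_(1 <= k < n.+1) k%:R * pmf (gain X n) k%:R)%:E)%E.
Proof.
move=> n_gt0; rewrite expectation_def.
have mG k : measurable (gain X n @^-1` [set k%:R]) by exact: measurable_funPTI.
transitivity (\int[P]_w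
  \sum_(1 <= k < n.+1) (k%:R * \1_(gain X n @^-1` [set k%:R]) w)%:E)%E.
  apply: eq_integral => w _; rewrite sumEFin; congr EFin.
  have /andP[G_gt0 Gn] := first_hit_bounds n (X ^~ w) n_gt0.
  (* Only the indicator of the value taken at [w] is nonzero. *)
  rewrite (big_rem (first_hit n (X ^~ w)))/= ?mem_index_iota ?G_gt0//.
  rewrite indicE gain_eq mem_set// mulr1 big1_seq ?addr0// => k /andP[_].
  rewrite mem_rem_uniq ?iota_uniq// inE => /andP[/eqP kG _].
  by rewrite indicE gain_eq memNset ?mulr0// => /esym.
have mI k :
  measurable_fun [set: T] (\1_(gain X n @^-1` [set k%:R]) : T -> R).
  exact: measurable_indic.
rewrite ge0_integral_sum//; last first.
  by move=> k; apply/measurable_EFinP; exact: measurable_funM.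
rewrite -sumEFin; apply: eq_bigr => k _.
under eq_integral do rewrite EFinM.
rewrite ge0_integralZl//; last exact/measurable_EFinP.
rewrite integral_indic// setIT EFinM; congr (_ * _)%E.
by rewrite fineK// fin_num_measure.
Qed.
End gain.

(** * Integrals of polynomials against exp(-t), and the incomplete Gamma function *)

Lemma cvgy_exprn_expRN (R : realType) (k : nat) :
  x ^+ k * expR (- x) @[x --> +oo%R] --> (0 : R).
Proof.
apply/cvgrPdist_le => e e0; near=> x.
have x0 : 0 < x by near: x; apply: nbhs_pinfty_gt; exact: num_real.
have c0 : 0 < k.+1%:R :> R by rewrite ltr0n.
rewrite sub0r normrN ger0_norm ?mulr_ge0 ?exprn_ge0 ?expR_ge0 ?(ltW x0)//.
(* Writing exp x as the (k+1)-st power of exp (x/(k+1)) bounds it below by a power of degree one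
   more than k. *)
have xc : (x / k.+1%:R) ^+ k.+1 <= expR x.
  rewrite -[in leRHS](divfK (lt0r_neq0 c0) x) expRM_natr.
  rewrite lerXn2r ?nnegrE ?expR_ge0 ?divr_ge0 ?(ltW x0) ?(ltW c0)//.
  by apply: le_trans (expR_ge1Dx _); rewrite lerDr.
rewrite expRN ler_pdivrMr ?expR_gt0//.
apply: le_trans (ler_wpM2l (ltW e0) xc).
rewrite expr_div_n exprSr mulrCA -mulrA ler_peMr ?exprn_ge0 ?(ltW x0)//.
(* The bound becomes x >= (k+1)^(k+1) / e, true for large x. *)
rewrite -ler_pdivrMr ?divr_gt0 ?exprn_gt0// mul1r.
Unshelve. all: by end_near. Qed.

Lemma cvgy_horner_expRN (R : realType) (p : {poly R}) :
  p.[x] * expR (- x) @[x --> +oo%R] --> (0 : R).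
Proof.
rewrite [X in X @ _](_ : _ =
    fun x : R => \sum_(i < size p) p`_i * (x ^+ i * expR (- x))); last first.
  apply/funext => x; rewrite horner_coef mulr_suml.
  by apply: eq_bigr => i _; rewrite mulrA.
rewrite [X in _ --> X](_ : 0 = \sum_(i < size p) p`_i * 0 :> R); last first.
  by rewrite big1// => i _; rewrite mulr0.
apply: cvg_big => [|i _]; first exact: add_continuous.
by apply: cvgMr; exact: cvgy_exprn_expRN.
Qed.

Lemma is_derive_horner_expRN (R : realType) (p : {poly R}) (t : R) :
  is_derive t 1 (fun u => p.[u] * expR (- u)) ((p^`() - p).[t] * expR (- t)).
Proof.
have dp : is_derive t 1 (horner p) p^`().[t].
  by rewrite derivE derive1E; exact/derivableP/derivable_horner.
have de : is_derive t 1 (fun u : R => expR (- u)) (- expR (- t)).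
  rewrite -mulrN1.
  exact: (@is_derive1_comp _ expR -%R).
apply: (is_derive_eq (is_deriveM dp de)).
rewrite /= /GRing.scale/= hornerD hornerN mulrBl mulrN.
by rewrite [expR _ * _]mulrC addrC.
Qed.

(** With q the sum of all derivatives of p, the function -q(t) exp(-t) is an antiderivative that
    tends to 0 at infinity. *)
Lemma integral_horner_expRN (R : realType) (p : {poly R}) (a : R) :
  (forall t, a <= t -> 0 <= p.[t]) ->
  (\int[lebesgue_measure]_(t in `[a, +oo[) (p.[t] * expR (- t))%:E =
    (expR (- a) * \sum_(0 <= i < size p) p^`(i).[a])%:E)%E.
Proof.
move=> p_ge0; set q := \sum_(0 <= i < size p) p^`(i).
(* Differentiating q shifts its terms by one, so the difference telescopes; the derivative of order
   [size p] is 0. *)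
have qE : q^`() - q = - p.
  rewrite /q raddf_sum/= -sumrB.
  under eq_bigr do rewrite -derivnS.
  by rewrite telescope_sumr// derivn_poly0// sub0r.
have cF (r : {poly R}) : continuous (fun u => r.[u] * expR (- u)).
  move=> t; apply/differentiable_continuous/derivable1_diffP.
  by case: (is_derive_horner_expRN R r t).
have dF := is_derive_horner_expRN R (- q).
rewrite (@ge0_continuous_FTC2y _ _ (fun t => (- q).[t] * expR (- t)) a 0).
- by rewrite hornerN horner_sum mulNr EFinN oppeK add0e mulrC.
- by move=> t ?; rewrite mulr_ge0 ?expR_ge0 ?p_ge0.
- exact/continuous_subspaceT/cF.
- exact: cvgy_horner_expRN.
- by move=> t _; case: (dF t).
- exact/cvg_at_right_filter/cF.
- move=> t _; rewrite derive1E (@derive_val _ _ _ _ _ _ _ (dF t)).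
  by rewrite derivN -opprD qE opprK.
Qed.

(** For t >= x >= 0 the real power with exponent (n+1)-1 is the monomial t^n, whose i-th derivative
    is [n ^_ i] times t^(n-i). *)
Lemma upper_incomplete_gammaS (R : realType) (n : nat) (x : R) : 0 <= x ->
  upper_incomplete_gamma n.+1%:R x =
  (expR (- x) * \sum_(0 <= i < n.+1) x ^+ (n - i) *+ n ^_ i)%:E.
Proof.
move=> x_ge0; rewrite /upper_incomplete_gamma.
transitivity (\int[lebesgue_measure]_(t in `[x, +oo[)
    ('X^n.[t] * expR (- t))%:E)%E.
  apply: eq_integral => t; rewrite inE/= in_itv/= andbT => xt.
  by rewrite -natr1 addrK powR_mulrn ?(le_trans x_ge0)// hornerXn.
rewrite integral_horner_expRN => [|t xt]; last first.
  by rewrite hornerXn exprn_ge0// (le_trans x_ge0).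
rewrite size_polyXn; congr (_ * _)%:E.
by apply: eq_bigr => i _; rewrite derivnXn hornerMn hornerXn.
Qed.

Theorem proposition4p1 (R : realType) (d : measure_display)
    (T : measurableType d) (P : probability T R) (n : nat) (n_gt0 : (0 < n)%N)
    (X : nat -> {RV P >-> nat})
    (X_unif : forall k, (0 < k)%N -> uniform_on_1n n (X k))
    (X_indep : mutually_independent [set k | (0 < k)%N] X) :
  ('E_P[gain X n] = (\sum_(1 <= k < n.+1) k%:R * pmf (gain X n) k%:R)%:E /\
   (\sum_(1 <= k < n.+1) k%:R * pmf (gain X n) k%:R)%:E =
     (expR n%:R * n%:R ^- n)%:E * upper_incomplete_gamma n.+1%:R n%:R - 1)%E.
Proof.
split; first exact: expectation_gain.
have n0 : n%:R != 0 :> R by rewrite pnatr_eq0 gtn_eqF.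
rewrite upper_incomplete_gammaS ?ler0n// -EFinM -EFinB; congr EFin.
pose S k : R := (n.-1 ^_ k)%:R / n%:R ^+ k.
transitivity (\sum_(0 <= k < n) S k).
  rewrite big_nat; under eq_bigr => k /andP[k_gt0 kn].
    rewrite (pmf_gain _ _ _ _ _ _ k)// ?k_gt0//; over.
  (* The boundary term of the Abel summation vanishes because [S n] is 0. *)
  rewrite -big_nat (sum_by_tails _ S) /S ffact_small ?ltn_predL//.
  by rewrite mul0r mulr0 subr0.
(* The exponentials cancel, and the term i = 0, equal to n^n / n^n = 1, absorbs the -1. *)
rewrite mulrACA expRxMexpNx_1 mul1r big_distrr/= big_nat_recl//.
rewrite subn0 ffactn0 mulr1n mulVf ?expf_neq0// addrC addKr.
(* The term of index k+1 equals [S k], since [n ^_ k.+1] is n times [n.-1 ^_ k]. *)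
rewrite big_nat [RHS]big_nat; apply: eq_bigr => k /= kn.
have -> : n%:R ^+ n = n%:R ^+ (n - k.+1) * n%:R ^+ k.+1 :> R.
  by rewrite -exprD subnK.
rewrite /S -[X in _ = _ * X]mulr_natl ffactnS natrM exprSr; field.
by rewrite n0 !expf_neq0.
Qed.
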